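(* Let $X$ be a complex Banach space, let $E \subset X'$ be a closed, almost norming vector subspace of the dual space $X'$, and let $T$ be a bounded linear operator on $X$. Let $F \subset (c_0)_+$ be a non-empty, at most countable set and suppose that $F$ governs the sequence $(\langle x', T^n x\rangle)_{n \in \mathbb{N}_0}$ for all $x \in X$ and all $x' \in E$. Then the spectral radius of $T$ satisfies $r(T) < 1$.
   Context: $X'$ is the space of all bounded linear functionals on $X$. A vector subspace $E \subset X'$ is called almost norming if there is a constant $C > 0$ such that $\|x\| \le \sup_{x' \in E,\, \|x'\| \le 1} C\,|\langle x', x\rangle|$ for all $x \in X$. $c_0 = c_0(\mathbb{N}_0;\mathbb{C})$ is the space of complex sequences indexed by $\mathbb{N}_0$ that converge to $0$, and $(c_0)_+$ is the set of those $f \in c_0$ all of whose entries are real and non-negative. For $g = (g_n) \in c_0$, $|g| := (|g_n|)_{n \in \mathbb{N}_0}$. Inequalities between real sequences are understood entrywise. For $f \in (c_0)_+$, the principal ideal generated by $f$ is $(c_0)_f = \{g \in c_0 : \exists c \ge 0,\ |g| \le c f\}$. For $h = (h_n)_{n\in\mathbb{N}_0} \in (c_0)_+$, $h^* \in (c_0)_+$ denotes its non-increasing rearrangement: the sequence obtained by listing the entries of $h$ in non-increasing order with multiplicities; explicitly, $h^*_n = \inf\{t \ge 0 : \#\{k \in \mathbb{N}_0 : h_k > t\} \le n\}$ for $n \in \mathbb{N}_0$. A non-empty set $F \subset (c_0)_+$ governs a complex sequence $a = (a_n)_{n \in \mathbb{N}_0}$ if $a \in c_0$ and there exists $f \in F$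 (possibly depending on $a$) such that the non-increasing rearrangement $|a|^*$ of $|a| = (|a_n|)_{n\in\mathbb{N}_0}$ belongs to $(c_0)_f$. *)

(* Defs.v *)
From HB Require Import structures.
From mathcomp Require Export all_boot all_order all_algebra.
From mathcomp Require Export all_classical all_reals all_analysis.
From mathcomp Require Export complex.
Set Implicit Arguments.
Unset Strict Implicit.
Unset Printing Implicit Defensive.
Import Order.TTheory GRing.Theory Num.Theory.
Import numFieldNormedType.Exports.
Local Open Scope classical_set_scope.
Local Open Scope card_scope.
Local Open Scope complex_scope.
Local Open Scope ring_scope.

(* Complex normed spaces are [normedModType R[i]]: their norm takes values in
   R[i], where [x <= y] means that [y - x] is real and nonnegative.  The scalar
   field, as a normed space over itself, is [R[i]^o]. *)

Section NormedSpaces.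
Context {R : realType}.

(* [`|x|] as an element of R, so that suprema can be taken. *)
Definition normR {V : normedModType R[i]} (x : V) : R := complex.Re `|x|.

Definition bounded_linear {V W : normedModType R[i]} (f : V -> W) : Prop :=
  linear f /\ exists M : R, forall x, normR (f x) <= M * normR x.

Section Dual.
Context {X : normedModType R[i]}.
Implicit Types (f g : X -> R[i]^o) (E : set (X -> R[i]^o)).

Definition dual : set (X -> R[i]^o) := [set f | bounded_linear f].

(* The value is only meaningful on [dual], where the set is bounded. *)
Definition dual_norm f : R :=
  sup [set normR (f x) | x in [set x : X | normR x <= 1]].

Definition dual_subspace E : Prop :=
  [/\ E `<=` dual, E 0 & forall (a : R[i]) f g, E f -> E g -> E (a *: f + g)].

(* Closed for the topology of the dual norm. *)
Definition dual_closed E : Prop :=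
  forall f, dual f ->
    (forall e : R, 0 < e -> exists2 g, E g & dual_norm (f - g) < e) -> E f.

Definition almost_norming E : Prop :=
  exists2 C : R, 0 < C & forall x : X,
    normR x <= sup [set C * normR (f x) | f in [set f | E f /\ dual_norm f <= 1]].

End Dual.

Section Spectrum.
Context {X : normedModType R[i]}.
Implicit Type T : X -> X.

Definition resolvent_set T : set R[i] :=
  [set l | exists S : X -> X,
     [/\ bounded_linear S,
         forall x, S (l *: x - T x) = x &
         forall x, l *: S x - T (S x) = x]].

Definition spectrum T : set R[i] := ~` resolvent_set T.

(* Taken in the extended reals so that no boundedness of the spectrum is
   presupposed; it is [-oo] when the spectrum is empty, i.e. when X = {0}. *)
Definition spectral_radius T : \bar R :=
  ereal_sup [set (normR (l : R[i]^o))%:E | l in spectrum T].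

End Spectrum.
End NormedSpaces.

Section Sequences.
Context {R : realType}.
Implicit Types (a f g h : nat -> R[i]^o) (F : set (nat -> R[i]^o)).

Definition c0 : set (nat -> R[i]^o) := [set a | a n @[n --> \oo] --> (0 : R[i]^o)].

Definition c0_pos : set (nat -> R[i]^o) :=
  [set f | c0 f /\ forall n, (0 : R[i]) <= f n].

Definition abs_seq a : nat -> R[i]^o := fun n => `|a n|.

Definition principal_ideal f : set (nat -> R[i]^o) :=
  [set g | c0 g /\
     exists2 c : R, 0 <= c & forall n, (abs_seq g n : R[i]) <= c%:C * f n].

Definition rearrangement h : nat -> R[i]^o := fun n =>
  (inf [set t : R | 0 <= t /\ [set k | t%:C < (h k : R[i])] #<= `I_n])%:C.

Definition governs F a : Prop :=
  c0 a /\ exists2 f, F f & principal_ideal f (rearrangement (abs_seq a)).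

End Sequences.

(* Main.v *)
(* Let c range over the countably many sequences m * (f_n + 1/(n+1)), f in F,
   m >= 1.  The pairs (x, x') in X * E whose weak orbit has at most n entries
   above c n, for every n, form a closed set, and these sets cover X * E.  By
   Baire one of them contains a ball, and expanding <h, T^k u> as a combination
   of four weak orbits from that ball gives, for (u, h) in a small ball around
   0, some k <= 4n with |<h, T^k u>| <= 4 (c n).  Were there approximate
   eigenvectors with |l| nearly 1 or larger, norming them by elements of E would
   contradict this for large n.  Hence l - T is bounded below by some d > 0
   uniformly in |l| >= 1 - d; since l - T is onto for large |l|, and being onto
   propagates over steps of length d/2, all such l are in the resolvent set. *)
Require Import Defs.
From mathcomp Require Import all_boot all_order all_algebra.
From mathcomp Require Import all_classical all_reals all_analysis.
From mathcomp Require Import complex lra ring zify.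
Import Order.TTheory GRing.Theory Num.Theory.
Import numFieldNormedType.Exports.
Set Implicit Arguments.
Unset Strict Implicit.
Unset Printing Implicit Defensive.
Local Open Scope classical_set_scope.
Local Open Scope complex_scope.
Local Open Scope ring_scope.

(** Generic in the field, so as to serve both [R] itself and spaces over [R[i]]. *)
Lemma cvgn_of_cauchy (K : numFieldType) (V : completeNormedModType K)
    (u : nat -> V) :
  (forall e : K, 0 < e -> exists N, forall m n, (N <= m)%N -> (N <= n)%N ->
     `|u m - u n| < e) -> cvgn u.
Proof.
move=> hu; apply/cauchy_cvgP; apply: cauchy_exP => e e0.
have [N hN] := hu e e0; exists (u N).
by exists N => // n /= Nn; rewrite -ball_normE /=; exact: hN.
Qed.

(** * Arithmetic of the real-valued norm *)

Section NormR.
Context {R : realType} {V : normedModType R[i]}.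
Implicit Types (x y z : V) (a : R[i]).

Lemma normRE x : `|x| = (normR x)%:C.
Proof. by rewrite /normR RRe_real // ger0_real. Qed.

Lemma normR_ge0 x : 0 <= normR x.
Proof. by rewrite -lecR -normRE normr_ge0. Qed.

Lemma normR0 : normR (0 : V) = 0.
Proof. by rewrite /normR normr0. Qed.

Lemma normR_eq0 x : normR x = 0 -> x = 0.
Proof. by move=> h; apply: normr0_eq0; rewrite normRE h. Qed.

Lemma normRD x y : normR (x + y) <= normR x + normR y.
Proof. by rewrite -lecR rmorphD /= -!normRE ler_normD. Qed.

Lemma normRN x : normR (- x) = normR x.
Proof. by rewrite /normR normrN. Qed.

Lemma normRBC x y : normR (x - y) = normR (y - x).
Proof. by rewrite -normRN opprB. Qed.

Lemma normR_triangle z x y : normR (x - y) <= normR (x - z) + normR (z - y).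
Proof. by rewrite -{1}(subrKA z) normRD. Qed.

Lemma normRZ a x : normR (a *: x) = normR (a : R[i]^o) * normR x.
Proof. by apply/complexI; rewrite rmorphM /= -!normRE normrZ. Qed.

Lemma le_normRB x y : normR x - normR y <= normR (x - y).
Proof. by rewrite lerBlDr -{1}(subrK y x) normRD. Qed.

End NormR.

Lemma normR_real (R : realType) (r : R) : normR (r%:C : R[i]^o) = `|r|.
Proof. by rewrite /normR normc_def /= expr0n addr0 sqrtr_sqr. Qed.

Lemma normRM (R : realType) (a b : R[i]^o) :
  normR (a * b : R[i]^o) = normR a * normR b.
Proof. exact: normRZ. Qed.

Lemma normR_Re (R : realType) (a : R[i]^o) : `|complex.Re a| <= normR a.
Proof. by rewrite -lecR -normRE normc_ge_Re. Qed.

Lemma normR_Im (R : realType) (a : R[i]^o) : `|complex.Im a| <= normR a.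
Proof.
rewrite /normR normc_def /= -sqrtr_sqr ler_wsqrtr// lerDr sqr_ge0 //.
Qed.

Lemma normR_le_ReIm (R : realType) (a : R[i]^o) :
  normR a <= `|complex.Re a| + `|complex.Im a|.
Proof.
case: a => [x y] /=.
have -> : x +i* y = (x%:C : R[i]^o) + ('i%C : R[i]) *: (y%:C : R[i]^o) :> R[i]^o.
  exact: complexE.
rewrite (le_trans (normRD _ _))// normRZ !normR_real.
have -> : normR ('i%C : R[i]^o) = 1.
  by rewrite /normR normc_def /= expr0n expr1n add0r sqrtr1.
by rewrite mul1r.
Qed.

(** * Limits and completeness with real epsilons *)

Section SequenceLimits.
Context {R : realType}.

Definition normR_cvg {V : normedModType R[i]} (u : nat -> V) (l : V) :=
  forall e : R, 0 < e -> exists N, forall n, (N <= n)%N -> normR (u n - l) < e.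

Definition normR_cauchy {V : normedModType R[i]} (u : nat -> V) :=
  forall e : R, 0 < e -> exists N, forall m n, (N <= m)%N -> (N <= n)%N ->
    normR (u m - u n) < e.

(** Lets a complex epsilon be traded for a real one. *)
Lemma ltc0P (e : R[i]) : 0 < e -> 0 < complex.Re e /\ e = (complex.Re e)%:C.
Proof.
by move=> e0; rewrite RRe_real ?gtr0_real//; split => //; move: e0; rewrite ltcE => /andP[].
Qed.

Lemma normR_complete (X : completeNormedModType R[i]) (u : nat -> X) :
  normR_cauchy u -> exists l, normR_cvg u l.
Proof.
move=> hu; have cu : cvgn u.
  apply: cvgn_of_cauchy => e /ltc0P[e0 ->].
  have [N hN] := hu _ e0; exists N => m n Nm Nn.
  by rewrite normRE ltcR hN.
exists (limn u) => e e0.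
have /cvgrPdist_lt/(_ e%:C) := cu; rewrite ltcR => /(_ e0) [N _ hN].
exists N => n Nn; rewrite normRBC -ltcR -normRE; exact: hN.
Qed.

Lemma real_complete (u : nat -> R) :
  (forall e, 0 < e -> exists N, forall m n, (N <= m)%N -> (N <= n)%N ->
     `|u m - u n| < e) ->
  exists l, forall e, 0 < e -> exists N, forall n, (N <= n)%N -> `|u n - l| < e.
Proof.
move=> hu; have cu : cvgn u by apply: (@cvgn_of_cauchy R R).
exists (limn u) => e e0.
have /cvgrPdist_lt/(_ e e0) [N _ hN] := cu.
by exists N => n Nn; rewrite distrC; exact: hN.
Qed.

Lemma complex_complete (u : nat -> R[i]^o) :
  normR_cauchy u -> exists l, normR_cvg u l.
Proof.
move=> hu.
have [|a ha] := @real_complete (fun n => complex.Re (u n)).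
  move=> e /hu[N hN]; exists N => m n Nm Nn.
  apply: le_lt_trans (hN m n Nm Nn).
  by have := normR_Re (u m - u n); case: (u m) (u n) => [? ?] [? ?].
have [|b hb] := @real_complete (fun n => complex.Im (u n)).
  move=> e /hu[N hN]; exists N => m n Nm Nn.
  apply: le_lt_trans (hN m n Nm Nn).
  by have := normR_Im (u m - u n); case: (u m) (u n) => [? ?] [? ?].
exists (a +i* b) => e e0.
have e20 : 0 < e / 2 by lra.
have [N hN] := ha _ e20; have [M hM] := hb _ e20.
exists (maxn N M) => n; rewrite geq_max => /andP[/hN Nn /hM Mn].
apply: le_lt_trans (normR_le_ReIm _) _.
by case: (u n) Nn Mn => x y /= Nn Mn; lra.
Qed.

End SequenceLimits.

(** * Consequences of linearity for bare functions *)

Section LinearMaps.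
Context {K : pzRingType} {V W : lmodType K} (f : V -> W).
Hypothesis lf : linear f.

Lemma linear_fun0 : f 0 = 0.
Proof. by have := lf (-1) 0 0; rewrite !scaleN1r !addNr. Qed.

Lemma linear_funD u v : f (u + v) = f u + f v.
Proof. by have := lf 1 u v; rewrite !scale1r. Qed.

Lemma linear_funZ a u : f (a *: u) = a *: f u.
Proof. by have := lf a u 0; rewrite linear_fun0 !addr0. Qed.

Lemma linear_funB u v : f (u - v) = f u - f v.
Proof. by rewrite -scaleN1r linear_funD linear_funZ scaleN1r. Qed.

End LinearMaps.

Lemma exprVn2_lt (R : realType) (d e : R) : 0 < e ->
  exists N, forall n, (N <= n)%N -> d * 2^-1 ^+ n < e.
Proof.
move=> e0.
have /cvgrPdist_lt/(_ e e0)[N _ hN] : geometric d (2^-1 : R) @ \oo --> (0 : R).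
  by apply: cvg_geometric; rewrite ger0_norm; lra.
exists N => n Nn; apply: le_lt_trans (hN n Nn).
by rewrite /= sub0r normrN ler_norm.
Qed.

(** * Fixed points, resolvent set and spectral radius *)

Section ResolventBound.
Context {R : realType} {X : completeNormedModType R[i]}.
Implicit Types (x y : X) (l : R[i]).

(** Banach's fixed point theorem with ratio 1/2; it stands in for the Neumann series when
    [l *: x - T x = y] is solved. *)
Lemma contraction_fixpoint (G : X -> X) :
  (forall x y, normR (G x - G y) <= 2^-1 * normR (x - y)) ->
  exists x, G x = x.
Proof.
move=> hG; pose u n := iter n G 0.
(* A geometric series of ratio 1/2 sums to twice its first term, so [d] bounds the distance from
   [u 0] to every iterate. *)
pose d := 2 * normR (u 1%N - u 0%N).
have u0 p : normR (u p - u 0%N) <= d.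
  elim: p => [|p IH]; first by rewrite subrr normR0 mulr_ge0 ?normR_ge0.
  have := normR_triangle (u 1%N) (u p.+1) (u 0%N).
  have := hG (u p) (u 0%N); rewrite /d in IH *.
  rewrite -[G (u p)]/(u p.+1) -[G (u 0%N)]/(u 1%N).
  by have := normR_ge0 (u 1%N - u 0%N); lra.
have un n p : normR (u (n + p)%N - u n) <= d * 2^-1 ^+ n.
  elim: n => [|n IH]; first by rewrite expr0 mulr1 u0.
  rewrite exprS mulrCA; apply: le_trans (hG (u (n + p)%N) (u n)) _.
  by rewrite ler_pM2l// invr_gt0 ltr0n.
have [|x hx] := @normR_complete R X u.
  move=> e e0; have e20 : 0 < e / 2 by lra.
  have [N hN] := exprVn2_lt d e20; exists N => m n Nm Nn.
  have := normR_triangle (u N) (u m) (u n).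
  have := un N (m - N)%N; have := un N (n - N)%N; rewrite !subnKC//.
  by rewrite (normRBC (u n)); have := hN N (leqnn _); lra.
exists x; apply/eqP; rewrite -subr_eq0; apply/eqP/normR_eq0/le_anti.
rewrite normR_ge0 andbT leNgt; apply/negP => g0.
have e0 : 0 < normR (G x - x) / 2 by lra.
have [N hN] := hx _ e0.
have := hN N (leqnn _); have := hN N.+1 (leqnSn _).
have := normR_triangle (u N.+1) (G x) x; have := hG x (u N).
rewrite -[G (u N)]/(u N.+1) (normRBC x (u N)).
lra.
Qed.

Variable T : X -> X.
Hypothesis lT : linear T.

(** The lower bound makes [l - T] injective, so a chosen right inverse is two-sided and linear; the
    same bound gives it norm at most [d^-1]. *)
Lemma resolvent_of_surjective l (d : R) : 0 < d ->
  (forall x, d * normR x <= normR (l *: x - T x)) ->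
  (forall y, exists x, l *: x - T x = y) -> resolvent_set T l.
Proof.
move=> d0 hd /choice[S hS].
pose A x := l *: x - T x.
have lA : linear A.
  move=> a u v; rewrite /A lT scalerBr opprD scalerDr !scalerA (mulrC l).
  by rewrite addrACA.
have Ainj x y : A x = A y -> x = y.
  move=> h; apply/eqP; rewrite -subr_eq0; apply/eqP/normR_eq0/le_anti.
  have := hd (x - y); rewrite -[l *: _ - _]/(A (x - y)) (linear_funB lA) h.
  by rewrite subrr normR0 normR_ge0 andbT pmulr_rle0.
exists S; split.
- split; first by move=> a u v; apply: Ainj; rewrite lA /A !hS.
  exists d^-1 => y; rewrite mulrC ler_pdivlMr// mulrC.
  by apply: le_trans (hd _) _; rewrite hS.
- by move=> x; apply: Ainj; exact: hS.
- by move=> x; exact: hS.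
Qed.

Hypothesis bT : exists M : R, forall x, normR (T x) <= M * normR x.

Lemma surjective_large : exists K : R, forall l, K <= normR (l : R[i]^o) ->
  forall y, exists x, l *: x - T x = y.
Proof.
(* The factor 2 gives contraction ratio 1/2 and the summand 1 keeps [l] nonzero; the sign of [M] is
   unknown, hence the absolute value. *)
have [M hM] := bT; exists (2 * `|M| + 1) => l hl y.
have Ml : 0 < normR (l : R[i]^o) by apply: lt_le_trans hl; have := normr_ge0 M; lra.
have l0 : l != 0 by apply: contraTneq Ml => ->; rewrite normR0 ltxx.
have [|x hx] := @contraction_fixpoint (fun x => l^-1 *: (y + T x)).
  move=> u v; rewrite -scalerBr normRZ opprD addrACA subrr add0r -(linear_funB lT).
  have -> : normR (l^-1 : R[i]^o) = (normR (l : R[i]^o))^-1.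
    apply: (mulfI (lt0r_neq0 Ml)); rewrite -normRM mulfV//.
    by rewrite divff ?lt0r_neq0// (normR_real (1 : R)) normr1.
  rewrite ler_pdivrMl// mulrA; apply: le_trans (hM _) _.
  apply: ler_wpM2r; first exact: normR_ge0.
  by have := ler_norm M; lra.
by exists x; rewrite -{1}hx scalerA mulfV// scale1r addrK.
Qed.

(** With [S] the inverse of [l - T], any [x = S (y + (l - l') *: x)] is a solution; the right side
    contracts because [S] has norm at most [d^-1]. *)
Lemma surjective_near l l' (d : R) : 0 < d ->
  (forall x, d * normR x <= normR (l *: x - T x)) ->
  (forall y, exists x, l *: x - T x = y) ->
  normR (l - l' : R[i]^o) <= d / 2 ->
  forall y, exists x, l' *: x - T x = y.
Proof.
move=> d0 hd sl ll' y.
have [S [[lS _] Sl lS']] := resolvent_of_surjective d0 hd sl.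
have [|x hx] := @contraction_fixpoint (fun x => S (y + (l - l') *: x)).
  move=> u v; rewrite -(linear_funB lS) opprD addrACA subrr add0r -scalerBr.
  rewrite (linear_funZ lS) normRZ.
  set w := S _; have := hd w; rewrite -{2}[w]/(S (u - v)) /w lS' => h.
  have h2 := ler_wpM2r (normR_ge0 (S (u - v))) ll'.
  apply: (le_trans h2); lra.
have := lS' (y + (l - l') *: x); rewrite hx scalerBl => E; exists x.
have -> : l' *: x - T x = (l *: x - T x) - (l *: x - l' *: x).
  by rewrite opprB [RHS]addrC subrKA.
by rewrite E addrK.
Qed.

Lemma resolvent_of_bounded_below (d : R) : 0 < d -> d < 1 ->
  (forall l x, 1 - d <= normR (l : R[i]^o) ->
     d * normR x <= normR (l *: x - T x)) ->
  forall l, 1 - d <= normR (l : R[i]^o) -> resolvent_set T l.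
Proof.
move=> d0 d1 hd l hl.
suff : forall y, exists x, l *: x - T x = y.
  by apply: resolvent_of_surjective d0 _ => x; exact: hd.
have [K hK] := surjective_large.
(* [n] steps of length [d / 2] suffice to push the modulus up to [K]; surjectivity then travels back
   along the ray. *)
have step n : forall l : R[i], 1 - d <= normR (l : R[i]^o) ->
    K <= normR (l : R[i]^o) + n%:R * (d / 2) ->
    forall y, exists x, l *: x - T x = y.
  elim: n => [|n IH] m hm hKm; first by apply: hK; rewrite mul0r addr0 in hKm.
  have m0 : 0 < normR (m : R[i]^o) by lra.
  pose t := d / 2 / normR (m : R[i]^o).
  have t0 : 0 < t by rewrite !divr_gt0.
  have tm : t * normR (m : R[i]^o) = d / 2 by rewrite divfK// lt0r_neq0.
  (* The point on the ray through [m] that lies further out by [d / 2], so [hd] applies there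
     too. *)
  pose m' : R[i] := (1 + t)%:C * m.
  have hm' : normR (m' : R[i]^o) = normR (m : R[i]^o) + d / 2.
    by rewrite normRM normR_real ger0_norm ?mulrDl ?mul1r ?tm//; lra.
  have hm'd : 1 - d <= normR (m' : R[i]^o) by lra.
  apply: (@surjective_near m' m d d0).
  - by move=> x; exact: hd.
  - by apply: IH => //; rewrite hm' -addrA; move: hKm; rewrite -natr1; lra.
  - have -> : m' - m = t%:C * m by rewrite /m' rmorphD /= mulrDl mul1r addrC addKr.
    by rewrite normRM normR_real ger0_norm ?tm// ltW.
have /archi_boundP := normr_ge0 (K / (d / 2)); set n := Num.bound _ => hn.
apply: (step n l hl).
have : K / (d / 2) < n%:R by apply: le_lt_trans hn; exact: ler_norm.
by rewrite ltr_pdivrMr; lra.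
Qed.

Lemma spectral_radius_lt1 (d : R) : 0 < d -> d < 1 ->
  (forall l x, 1 - d <= normR (l : R[i]^o) ->
     d * normR x <= normR (l *: x - T x)) ->
  (spectral_radius T < 1)%E.
Proof.
move=> d0 d1 hd; apply: (@le_lt_trans _ _ (1 - d)%:E); last by rewrite lte_fin; lra.
apply: ge_ereal_sup => _ [l sl <-]; rewrite lee_fin leNgt; apply/negP => /ltW hl.
exact: sl (resolvent_of_bounded_below d0 d1 hd hl).
Qed.

End ResolventBound.

(** * The dual norm *)

Section DualNorm.
Context {R : realType} {X : normedModType R[i]}.
Implicit Types (f : X -> R[i]^o) (x : X).

Lemma le_dual_norm f x : dual f -> normR (f x) <= dual_norm f * normR x.
Proof.
move=> [lf [M hM]].
have [/normR_eq0 ->|x0] := eqVneq (normR x) 0.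
  by rewrite (linear_fun0 lf) !normR0 mulr0.
have {x0}x0 : 0 < normR x by rewrite lt0r x0 normR_ge0.
rewrite -ler_pdivrMr// mulrC.
have nx : `|(normR x)^-1| = (normR x)^-1 by rewrite ger0_norm// invr_ge0 ltW.
have -> : (normR x)^-1 * normR (f x) = normR (f (((normR x)^-1)%:C *: x)).
  by rewrite (linear_funZ lf) normRZ normR_real nx.
apply: ub_le_sup; last first.
  exists (((normR x)^-1)%:C *: x) => //=.
  by rewrite normRZ normR_real nx mulVf ?lt0r_neq0.
exists `|M| => _ [y /= y1 <-]; apply: le_trans (hM y) _.
apply: (@le_trans _ _ (`|M| * normR y)).
  by rewrite ler_wpM2r ?normR_ge0 ?ler_norm.
by rewrite -[leRHS]mulr1 ler_wpM2l.
Qed.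

Lemma dual_norm_le f (r : R) : 0 <= r ->
  (forall x, normR (f x) <= r * normR x) -> dual_norm f <= r.
Proof.
move=> r0 hf; apply: ge_sup.
  by exists (normR (f 0)), 0 => //=; rewrite normR0 ler01.
move=> _ [x /= x1 <-]; apply: le_trans (hf x) _.
by rewrite -[leRHS]mulr1 ler_wpM2l.
Qed.

End DualNorm.

Lemma le_geometric_le0 (R : realType) (c d : R) :
  (forall n, c <= d * 2^-1 ^+ n) -> c <= 0.
Proof.
move=> h; rewrite leNgt; apply/negP => c0.
by have [N /(_ _ (leqnn N))] := exprVn2_lt d c0; rewrite ltNge h.
Qed.

Lemma normR_cvg_le (R : realType) (V : normedModType R[i]) (u : nat -> V) l c
    (r : R) N : normR_cvg u l ->
  (forall n, (N <= n)%N -> normR (u n - c) <= r) -> normR (l - c) <= r.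
Proof.
move=> ul h; apply/ler_addgt0Pr => e /ul[M hM].
have := normR_triangle (u (maxn N M)) l c; rewrite (normRBC l (u _)).
have := h _ (leq_maxl N M); have := hM _ (leq_maxr N M); lra.
Qed.

(** * Baire's theorem on the product of [X] and [E] *)

Section Baire.
Context {R : realType} {X : completeNormedModType R[i]}.
Variable E : set (X -> R[i]^o).
Implicit Types (x y z : X) (f g : X -> R[i]^o).

(** Closed ball for the maximum of the two norms. The dual-norm distance is spelled out pointwise,
    which avoids a supremum. *)
Definition pair_ball x f (r : R) : set (X * (X -> R[i]^o)) :=
  [set p | [/\ E p.2, normR (p.1 - x) <= r &
               forall z, normR (p.2 z - f z) <= r * normR z]].

Hypothesis dE : dual_subspace E.
Hypothesis cE : dual_closed E.

Lemma pair_ball_center x f (r : R) : E f -> 0 <= r -> pair_ball x f r (x, f).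
Proof.
move=> Ef r0; split; rewrite ?subrr ?normR0// => z.
by rewrite subrr normR0 mulr_ge0 ?normR_ge0.
Qed.

Lemma pair_ball_sub x f (r : R) y g (s : R) :
  pair_ball x f r (y, g) -> pair_ball y g s `<=` pair_ball x f (r + s).
Proof.
move=> [/= Eg yx gf] [z h] [/= Eh zy hg]; split => //=.
  by have := normR_triangle y z x; lra.
move=> w; have := normR_triangle (g w) (h w) (f w).
by have := gf w; have := hg w; rewrite mulrDl; lra.
Qed.

(** The first hypothesis says that each [A j] is closed in the product. If none contained a ball,
    nested balls avoiding [A 0], [A 1], ... in turn would, as [X] is complete and [E] closed, have a
    common point outside every [A j]. *)
Lemma baire_pair (A : nat -> set (X * (X -> R[i]^o))) :
  (forall j x f, E f -> ~ A j (x, f) ->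
     exists2 r : R, 0 < r & pair_ball x f r `<=` ~` A j) ->
  (forall x f, E f -> exists j, A j (x, f)) ->
  exists j x f, E f /\ exists2 r : R, 0 < r & pair_ball x f r `<=` A j.
Proof.
move=> oA cA; apply: contrapT => nA.
pose state := (X * (X -> R[i]^o) * R)%type.
pose ok (s : state) := E s.1.2 /\ 0 < s.2.
pose bl (s : state) := pair_ball s.1.1 s.1.2 s.2.
(* Validity is a premise inside the existential, so that [choice] yields a total function; an
   invalid state is returned unchanged. *)
have stepP (p : nat * state) : exists s' : state, ok p.2 ->
    [/\ ok s', s'.2 <= p.2.2 * 2^-1, bl s' `<=` bl p.2 & bl s' `<=` ~` A p.1].
  case: p => j [[x f] r]; rewrite /ok /bl /=.
  have [[Ef r0]|] := pselect (E f /\ 0 < r); last by exists (x, f, r).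
  have r20 : 0 < r * 2^-1 by lra.
  (* The point is sought in the half-radius ball, so that a ball of radius at most [r / 2] around it
     stays within the old one. *)
  have /existsNP[[y g] /not_implyP[yg nAyg]] : ~ (pair_ball x f (r * 2^-1) `<=` A j).
    by move=> h; apply: nA; exists j, x, f; split => //; exists (r * 2^-1).
  have Eg : E g by case: yg.
  have [s s0 hs] := oA j y g Eg nAyg.
  have sm : pair_ball y g (Num.min s (r * 2^-1)) `<=` pair_ball y g s.
    move=> [z h] [/= Eh h1 h2]; split => //= [|w].
      by apply: le_trans h1 _; rewrite ge_min lexx.
    by apply: le_trans (h2 w) _; rewrite ler_wpM2r ?normR_ge0// ge_min lexx.
  exists (y, g, Num.min s (r * 2^-1)) => _ /=; split.
  - by rewrite lt_min s0 r20.
  - by rewrite ge_min lexx orbT.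
  - move=> q /(pair_ball_sub yg) [Eq q1 q2].
    have sr : r * 2^-1 + Num.min s (r * 2^-1) <= r.
      suff : Num.min s (r * 2^-1) <= r * 2^-1 by lra.
      by rewrite ge_min lexx orbT.
    split => // [|w]; first exact: le_trans q1 sr.
    by apply: le_trans (q2 w) _; rewrite ler_wpM2r ?normR_ge0.
  - by move=> q /sm /hs.
have [step hstep] := choice stepP.
pose s := fix s n : state := if n is m.+1 then step (m, s m) else (0, 0, 1).
have E0 : E 0 by case: dE.
have oks n : ok (s n).
  by elim: n => [|n /(hstep (n, s n))[]]//; split => //=.
have ss n := hstep (n, s n) (oks n).
have rs n : (s n).2 <= 2^-1 ^+ n.
  elim: n => [|n IH]; first by rewrite expr0.
  have [_ h _ _] := ss n; apply: le_trans h _.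
  by rewrite exprSr ler_wpM2r// invr_ge0.
have bs n m : (n <= m)%N -> bl (s m) `<=` bl (s n).
  move=> /subnKC <-; elim: (m - n)%N => [|k IH]; first by rewrite addn0.
  by rewrite addnS => q; have [_ _ h _] := ss (n + k)%N; move=> /h/IH.
have bc n m : (n <= m)%N -> bl (s n) (s m).1.
  move=> nm; apply: (bs n m nm); have [Ef r0] := oks m.
  by rewrite /bl; case: (s m).1 Ef => y g /= Eg; apply: pair_ball_center => //; exact: ltW.
have xE n m : (n <= m)%N -> normR ((s m).1.1 - (s n).1.1) <= (s n).2.
  by move=> /bc[].
have fE n m z : (n <= m)%N ->
    normR ((s m).1.2 z - (s n).1.2 z) <= (s n).2 * normR z.
  by move=> /bc[].
have cauchy2 (V : normedModType R[i]) (u : nat -> V) (d : R) :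
    (forall n m, (n <= m)%N -> normR (u m - u n) <= d * 2^-1 ^+ n) ->
    normR_cauchy u.
  move=> hu e e0; have e20 : 0 < e / 2 by lra.
  have [N /(_ _ (leqnn N)) hN] := exprVn2_lt d e20; exists N => m n Nm Nn.
  have := normR_triangle (u N) (u m) (u n); rewrite (normRBC (u N) (u n)).
  by have := hu _ _ Nm; have := hu _ _ Nn; lra.
have [|x hx] := @normR_complete R X (fun n => (s n).1.1).
  apply: (@cauchy2 _ _ 1) => n m nm; rewrite mul1r.
  exact: le_trans (xE _ _ nm) (rs n).
(* The limit functional is built pointwise; linearity, boundedness and membership in [E] follow
   below. *)
have /choice[g hg] z : exists l : R[i]^o, normR_cvg (fun n => (s n).1.2 z) l.
  apply: complex_complete; apply: (@cauchy2 _ _ (normR z)) => n m nm.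
  apply: le_trans (fE _ _ z nm) _.
  by rewrite mulrC ler_wpM2l ?normR_ge0.
have xs n : normR (x - (s n).1.1) <= (s n).2 by apply: (normR_cvg_le hx (xE n)).
have gs n z : normR (g z - (s n).1.2 z) <= (s n).2 * normR z.
  by apply: (normR_cvg_le (hg z)) => m; exact: fE.
have gs2 n z : normR (g z - (s n).1.2 z) <= normR z * 2^-1 ^+ n.
  by apply: le_trans (gs n z) _; rewrite mulrC ler_wpM2l ?normR_ge0.
have [sE _ _] := dE.
have dg : dual g.
  split.
    move=> a u v; apply/eqP; rewrite -subr_eq0; apply/eqP/normR_eq0/le_anti.
    rewrite normR_ge0 andbT.
    (* The functional of the [n]-th ball is linear and [2^-1 ^+ n]-close to [g], so the linearity
       defect of [g] is at most this constant times [2^-1 ^+ n] for every [n]. *)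
    apply: (@le_geometric_le0 _ _ (normR (a *: u + v) +
      normR (a : R[i]^o) * normR u + normR v)) => n.
    have [/sE[lf _] _] := oks n.
    have -> : g (a *: u + v) - (a *: g u + g v) =
      (g (a *: u + v) - (s n).1.2 (a *: u + v)) +
      (- (a *: (g u - (s n).1.2 u)) + - (g v - (s n).1.2 v)).
      by rewrite lf scalerBr !opprB [X in _ = _ + X]addrACA -opprD subrKA.
    apply: le_trans (normRD _ _) _; rewrite -addrA mulrDl lerD// mulrDl.
    apply: le_trans (normRD _ _) _; rewrite !normRN lerD// normRZ -mulrA.
    by rewrite ler_wpM2l ?normR_ge0.
  have [/sE[_ [M hM]] _] := oks 0%N.
  exists (M + 1) => z; have := hM z; have := gs 0%N z.
  by have := le_normRB (g z) ((s 0%N).1.2 z); rewrite /= mulrDl mul1r; lra.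
have Eg : E g.
  apply: cE => // e /(exprVn2_lt 1)[N /(_ _ (leqnn N))]; rewrite mul1r => hN.
  have [Ef r0] := oks N; exists (s N).1.2 => //.
  apply: le_lt_trans hN; apply: le_trans (rs N).
  by apply: dual_norm_le; [exact: ltW|exact: gs].
have [j Aj] := cA x g Eg.
(* The limit pair lies in ball [j.+1], which was chosen to avoid [A j]. *)
have [_ _ _ /(_ (x, g))] := ss j; apply => //; split => //; [exact: (xs j.+1)|exact: (gs j.+1)].
Qed.

End Baire.

(** * Counting large entries *)

Section Sparse.
Context {R : realType}.
Implicit Types (c : nat -> R) (a b : nat -> R[i]^o).

(* Equivalent to |a|^* <= c, where |a|^* is the non-increasing rearrangement. *)
Definition sparse c a := forall n L,
  (count (fun k => (c n < normR (a k))%R) (iota 0 L) <= n)%N.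

(** Each sequence exceeds [c n] at most [n] times, so of the [4 * n + 1] indices up to [4 * n] at
    least one is exceptional for none of the four. *)
Lemma sparse_sum4 c (a1 a2 a3 a4 : nat -> R[i]^o) n :
  sparse c a1 -> sparse c a2 -> sparse c a3 -> sparse c a4 ->
  exists2 k, (k <= 4 * n)%N &
    normR (a1 k) + normR (a2 k) + normR (a3 k) + normR (a4 k) <= 4 * c n.
Proof.
move=> /(_ n (4 * n).+1) h1 /(_ n (4 * n).+1) h2.
move=> /(_ n (4 * n).+1) h3 /(_ n (4 * n).+1) h4.
apply: contrapT => nex.
set p1 := fun k => _ in h1; set p2 := fun k => _ in h2.
set p3 := fun k => _ in h3; set p4 := fun k => _ in h4.
have cU (p q : pred nat) s : (count (predU p q) s <= count p s + count q s)%N.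
  by rewrite -count_predUI leq_addr.
suff : all (predU p1 (predU p2 (predU p3 p4))) (iota 0 (4 * n).+1).
  rewrite all_count size_iota => /eqP cE.
  have := cU p1 (predU p2 (predU p3 p4)) (iota 0 (4 * n).+1).
  have := cU p2 (predU p3 p4) (iota 0 (4 * n).+1).
  have := cU p3 p4 (iota 0 (4 * n).+1).
  by rewrite cE; lia.
apply/allP => k; rewrite mem_iota add0n /= ltnS => kn.
apply: contrapT => /negP; rewrite /p1 /p2 /p3 /p4 !negb_or -!leNgt => /and4P[k1 k2 k3 k4].
by apply: nex; exists k => //; lra.
Qed.

End Sparse.

(** Used to make finitely many perturbation conditions hold on one ball. *)
Lemma exists_min_radius (R : realType) (P : nat -> R -> Prop) L :
  (forall k r s, s <= r -> P k r -> P k s) ->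
  (forall k, exists2 r : R, 0 < r & P k r) ->
  exists2 r : R, 0 < r & forall k, (k < L)%N -> P k r.
Proof.
move=> mP hP; elim: L => [|L [r r0 hr]]; first by exists 1.
have [s s0 hs] := hP L; exists (Num.min r s); first by rewrite lt_min r0.
move=> k; rewrite ltnS leq_eqVlt => /predU1P[->|/hr].
  by apply: mP hs; rewrite ge_min lexx orbT.
by apply: mP; rewrite ge_min lexx.
Qed.

(** * Weak orbits: perturbation, polarization, approximate eigenvectors *)

Section Orbits.
Context {R : realType} {X : completeNormedModType R[i]}.
Variables (T : X -> X) (E : set (X -> R[i]^o)).
Hypothesis bT : bounded_linear T.
Hypothesis dE : dual_subspace E.
Implicit Types (x y : X) (f g : X -> R[i]^o).

Lemma linear_iter k : linear (iter k T).
Proof.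
have [lT _] := bT.
by elim: k => [//|k IH] a u v; rewrite !iterS IH lT.
Qed.

Lemma bounded_ge1 : exists2 M : R, 1 <= M &
  (forall x, normR (T x) <= M * normR x).
Proof.
have [_ [M hM]] := bT; exists (`|M| + 1) => [|x]; first by rewrite lerDr.
apply: le_trans (hM x) _; rewrite ler_wpM2r ?normR_ge0//.
by have := ler_norm M; lra.
Qed.

Lemma iter_bound (M : R) k x : 0 <= M ->
  (forall x, normR (T x) <= M * normR x) ->
  normR (iter k T x) <= M ^+ k * normR x.
Proof.
move=> M0 hM; elim: k => [|k IH]; first by rewrite expr0 mul1r.
rewrite iterS; apply: le_trans (hM _) _.
by rewrite exprS -mulrA ler_wpM2l.
Qed.

Definition weak_orbit x f : nat -> R[i]^o := fun k => f (iter k T x).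

Lemma weak_orbit_perturb x f k (e : R) : E f -> 0 < e ->
  exists2 r : R, 0 < r & forall y g, pair_ball E x f r (y, g) ->
    normR (weak_orbit x f k) - e < normR (weak_orbit y g k).
Proof.
move=> Ef e0; have [sE _ _] := dE.
have [lf [c hc]] := sE _ Ef; have [M M1 hM] := bounded_ge1.
(* Change of the orbit entry per unit of radius: [M ^+ k * (normR x + 1)] from moving [f], and the
   term with [c] from moving [x]. *)
pose D := M ^+ k * (normR x + 1 + `|c|).
have M0 : 0 <= M ^+ k by rewrite exprn_ge0//; lra.
have D0 : 0 <= D by rewrite mulr_ge0// !addr_ge0// normR_ge0.
have De : 0 < e / (D + 1) by rewrite divr_gt0//; lra.
exists (Num.min 1 (e / (D + 1))); first by rewrite lt_min ltr01.
set r := Num.min _ _.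
have r1 : r <= 1 by rewrite ge_min lexx.
have r0 : 0 < r by rewrite lt_min ltr01.
(* The extra 1 makes [r * D < e] strict. *)
have rD : r * (D + 1) <= e by rewrite -ler_pdivlMr ?ge_min ?lexx ?orbT//; lra.
move=> y g [/= _ yx gf]; rewrite /weak_orbit ltrBlDr -ltrBlDl.
have ny : normR y <= normR x + 1.
  by have := le_normRB y x; lra.
have hy : normR (iter k T y) <= M ^+ k * (normR x + 1).
  by apply: le_trans (iter_bound _ _ _ hM) _; [lra|rewrite ler_wpM2l].
have h1 : normR (g (iter k T y) - f (iter k T y)) <= r * (M ^+ k * (normR x + 1)).
  by apply: le_trans (gf _) _; rewrite ler_wpM2l// ltW.
have h2 : normR (f (iter k T y) - f (iter k T x)) <= r * (M ^+ k * `|c|).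
  rewrite -(linear_funB lf) -(linear_funB (linear_iter k)).
  apply: le_trans (hc _) _.
  apply: (@le_trans _ _ (`|c| * normR (iter k T (y - x)))).
    by rewrite ler_wpM2r ?normR_ge0 ?ler_norm.
  rewrite mulrA mulrC ler_wpM2r//.
  apply: le_trans (@iter_bound M k _ _ hM) _; first by lra.
  by rewrite mulrC ler_wpM2r.
have := normR_triangle (f (iter k T y)) (g (iter k T y)) (f (iter k T x)).
have := le_normRB (f (iter k T x)) (g (iter k T y)); rewrite normRBC.
have : r * (M ^+ k * (normR x + 1)) + r * (M ^+ k * `|c|) = r * D.
  by rewrite -mulrDr -mulrDr.
move: rD; rewrite mulrDr mulr1.
lra.
Qed.

(** A failure of sparsity is witnessed by finitely many strict inequalities, each stable under small
    perturbations. This is the closedness required by [baire_pair]. *)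
Lemma not_sparse_open (c : nat -> R) x f : E f -> ~ sparse c (weak_orbit x f) ->
  exists2 r : R, 0 < r & forall y g, pair_ball E x f r (y, g) ->
    ~ sparse c (weak_orbit y g).
Proof.
move=> Ef /existsNP[n /existsNP[L /negP]]; rewrite -ltnNge => hL.
have [||r r0 hr] := @exists_min_radius R
  (fun k r => forall y g, pair_ball E x f r (y, g) ->
    c n < normR (weak_orbit x f k) -> c n < normR (weak_orbit y g k)) L.
- move=> k r s sr h y g [/= Eg yx gf]; apply: h; split => //= [|z].
    exact: le_trans yx sr.
  by apply: le_trans (gf z) _; rewrite ler_wpM2r ?normR_ge0.
- move=> k; have [h|/negP h] := boolP (c n < normR (weak_orbit x f k)); last by exists 1.
  have e0 : 0 < normR (weak_orbit x f k) - c n by rewrite subr_gt0.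
  have [r r0 hr] := weak_orbit_perturb x k Ef e0; exists r => // y g /hr.
  by rewrite subKr.
exists r => // y g byg /(_ n L); apply/negP; rewrite -ltnNge.
apply: leq_trans hL _.
rewrite (@eq_in_count _ _ (predI (fun k => c n < normR (weak_orbit y g k))
  (fun k => c n < normR (weak_orbit x f k)))) => [|k].
  by apply: sub_count => k /andP[].
rewrite mem_iota add0n => /andP[_ kL] /=.
case: (ltP (c n) (normR (weak_orbit x f k))) => [h|_]; rewrite ?andbF ?andbT //.
by symmetry; exact: hr.
Qed.


(** The entry of [(u, h)] is the second difference of the entries at the corners [(x0 + u, f0 + h)],
    [(x0, f0 + h)], [(x0 + u, f0)], [(x0, f0)], all in the ball; [sparse_sum4] makes the four small
    at one index. *)
Lemma sparse_polarization (c : nat -> R) x0 f0 (r : R) : E f0 ->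
  (forall y g, pair_ball E x0 f0 r (y, g) -> sparse c (weak_orbit y g)) ->
  forall u h, E h -> normR u <= r -> (forall z, normR (h z) <= r * normR z) ->
  forall n, exists2 k, (k <= 4 * n)%N & normR (weak_orbit u h k) <= 4 * c n.
Proof.
move=> Ef0 hs u h Eh ur hr n; have [sE _ aE] := dE.
have r0 : 0 <= r by apply: le_trans ur; exact: normR_ge0.
have Ef0h : E (f0 + h) by rewrite -[f0]scale1r; exact: aE.
have ball_f0 x : normR (x - x0) <= r -> pair_ball E x0 f0 r (x, f0).
  by move=> hx; split => //= z; rewrite subrr normR0 mulr_ge0 ?normR_ge0.
have ball_h x : normR (x - x0) <= r -> pair_ball E x0 f0 r (x, f0 + h).
  by move=> hx; split => //= z; rewrite addrC addKr.
have c0 : normR (x0 - x0) <= r by rewrite subrr normR0.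
have c1 : normR (x0 + u - x0) <= r by rewrite addrC addKr.
have [k kn hk] := sparse_sum4 n (hs _ _ (ball_h _ c1)) (hs _ _ (ball_h _ c0))
  (hs _ _ (ball_f0 _ c1)) (hs _ _ (ball_f0 _ c0)).
exists k => //; apply: le_trans hk.
have [[lf0 _] [lh _]] := (sE _ Ef0, sE _ Eh).
have -> : weak_orbit u h k = (weak_orbit (x0 + u) (f0 + h) k - weak_orbit x0 (f0 + h) k)
    + (- weak_orbit (x0 + u) f0 k + weak_orbit x0 f0 k).
  rewrite /weak_orbit (linear_funD (linear_iter k)).
  set p := iter k T x0; set q := iter k T u.
  rewrite -[(f0 + h) (p + q)]/(f0 (p + q) + h (p + q)) -[(f0 + h) p]/(f0 p + h p).
  rewrite (linear_funD lf0) (linear_funD lh).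
  have pol (a b d e : R[i]) : e = (a + b + (d + e) - (a + d)) + (- (a + b) + a).
    by ring.
  exact: pol.
apply: le_trans (normRD _ _) _; rewrite -[leRHS]addrA lerD//.
  by apply: le_trans (normRD _ _) _; rewrite normRN.
by apply: le_trans (normRD _ _) _; rewrite normRN.
Qed.

(** Telescoping: each step applies [T] to the previous error and adds [l ^+ k] times the defect
    [l *: x - T x]; [1 <= M] absorbs the missing factor [M]. *)
Lemma approx_eigenvector_iter (M : R) (l : R[i]) x k : 1 <= M ->
  (forall x, normR (T x) <= M * normR x) -> normR (l : R[i]^o) <= M ->
  normR (iter k T x - l ^+ k *: x) <= k%:R * M ^+ k * normR (l *: x - T x).
Proof.
move=> M1 hM lM; have [lT _] := bT; elim: k => [|k IH].
  by rewrite expr0 scale1r subrr normR0 !mul0r.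
have -> : iter k.+1 T x - l ^+ k.+1 *: x =
    T (iter k T x - l ^+ k *: x) - l ^+ k *: (l *: x - T x).
  rewrite iterS (linear_funB lT) (linear_funZ lT) scalerBr scalerA -exprSr.
  by rewrite opprB subrKA.
apply: le_trans (normRD _ _) _; rewrite normRN normRZ.
have lk : normR (l ^+ k : R[i]^o) <= M ^+ k.
  elim: k {IH} => [|k IH]; first by rewrite !expr0 (normR_real (1 : R)) normr1.
  rewrite !exprS (@normRM R l) ler_pM ?normR_ge0//.
set d := normR (l *: x - T x) in IH *.
have d0 : 0 <= d by exact: normR_ge0.
have h1 := hM (iter k T x - l ^+ k *: x).
have h2 : M * normR (iter k T x - l ^+ k *: x) <= M * (k%:R * M ^+ k * d).
  by rewrite ler_wpM2l//; lra.
have h3 : normR (l ^+ k : R[i]^o) * d <= M ^+ k * d by rewrite ler_wpM2r.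
have h4 : M ^+ k * d <= M * (M ^+ k * d).
  by rewrite ler_peMl// mulr_ge0// exprn_ge0//; lra.
rewrite -natr1 exprS !mulrDl mul1r -!mulrA; rewrite -!mulrA in h2.
by rewrite (mulrCA k%:R M); lra.
Qed.

End Orbits.

Lemma bernoulli_le (R : realType) (d : R) k : 0 <= d <= 1 ->
  1 - k%:R * d <= (1 - d) ^+ k.
Proof.
move=> /andP[d0 d1]; elim: k => [|k IH]; first by rewrite mul0r subr0 expr0.
rewrite exprS.
have : (1 - d) * (1 - k%:R * d) <= (1 - d) * (1 - d) ^+ k.
  by rewrite ler_wpM2l//; lra.
have : 0 <= k%:R * d * d by rewrite !mulr_ge0.
by rewrite -natr1; lra.
Qed.

(** * A uniform lower bound for [l - T] *)

Section BoundedBelow.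
Context {R : realType} {X : completeNormedModType R[i]}.
Variables (T : X -> X) (E : set (X -> R[i]^o)).
Hypothesis bT : bounded_linear T.
Hypothesis dE : dual_subspace E.

(** The supremum is at least 1 but need not be attained, hence the threshold 1/2. *)
Lemma almost_norming_unit : almost_norming E -> exists2 C : R, 0 < C &
  forall x : X, normR x = 1 -> exists f,
    [/\ E f, forall z, normR (f z) <= normR z & 1 / 2 < C * normR (f x)].
Proof.
move=> [C C0 hC]; exists C => // x x1; have [sE E0 _] := dE.
have [||_ [f /= [Ef f1] <-] hf] := @sup_gt R
  [set C * normR (f x) | f in [set f | E f /\ dual_norm f <= 1]] (1 / 2).
- exists (C * normR ((0 : X -> R[i]^o) x)); exists 0 => //; split => //.
  by apply: dual_norm_le => // z; rewrite normR0 mul1r normR_ge0.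
- by apply: lt_le_trans (hC x); rewrite x1; lra.
exists f; split => // z.
apply: le_trans (le_dual_norm z (sE _ Ef)) _.
by rewrite -[leRHS]mul1r ler_wpM2r ?normR_ge0.
Qed.

(** If the bound fails at [x], let [y] be [x] normalized and [f] nearly norming for [y]. Up to
    [k = 4 * n], [T^k y] stays near [l ^+ k *: y], so [C * normR (f (T^k y))] is at least 1/8,
    whereas smallness of some weak orbit entry forces it below 1/8. *)
Lemma bounded_below_of_sparse (c : nat -> R) (r : R) : almost_norming E ->
  0 < r -> (forall e : R, 0 < e -> exists n, c n < e) ->
  (forall (u : X) (h : X -> R[i]^o), E h -> normR u <= r ->
     (forall z, normR (h z) <= r * normR z) ->
     forall n, exists2 k, (k <= 4 * n)%N & normR (weak_orbit T u h k) <= 4 * c n) ->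
  exists d : R, [/\ 0 < d, d < 1 & forall (l : R[i]) x,
    1 - d <= normR (l : R[i]^o) -> d * normR x <= normR (l *: x - T x)].
Proof.
move=> /almost_norming_unit[C C0 hC] r0 hc hr.
have [M M1 hM] := bounded_ge1 bT.
(* The polarized bound [4 * c n], divided by [r * r] and multiplied by [C], is to fall below 1/8. *)
have e0 : 0 < r * r / (32 * C) by rewrite divr_gt0 ?mulr_gt0//; lra.
have [n hn] := hc _ e0; pose N : R := (4 * n)%:R; pose K := M + 1.
have N0 : 0 <= N by [].
have KN : 0 <= C * N * K ^+ (4 * n).
  by rewrite !mulr_ge0// ?exprn_ge0 ?ltW// /K; lra.
(* With [d = A^-1], the three summands give [d <= 1/2], [d * N <= 1/2] (so [(1 - d) ^+ k >= 1/2] by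
   Bernoulli) and an iteration error of at most 1/8. The choice precedes [l], so [d] is uniform. *)
pose A := 2 + 2 * N + 8 * (C * N * K ^+ (4 * n)).
pose d := A^-1.
have A2 : 2 <= A by rewrite /A; lra.
have dA : d * A = 1 by rewrite mulVf// gt_eqF//; lra.
have d0 : 0 < d by rewrite invr_gt0; lra.
have dN : 0 <= d * N by rewrite mulr_ge0// ltW.
have dKN : 0 <= d * (C * N * K ^+ (4 * n)) by rewrite mulr_ge0// ltW.
have dAE : d * 2 + 2 * (d * N) + 8 * (d * (C * N * K ^+ (4 * n))) = 1.
  by rewrite -[RHS]dA /A; ring.
exists d; split => //; first by lra.
move=> l x hl; rewrite leNgt; apply/negP => hx.
have x0 : 0 < normR x.
  rewrite lt0r normR_ge0 andbT; apply/eqP => x0.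
  by move: hx; rewrite x0 mulr0 ltNge normR_ge0.
have [lT _] := bT.
pose y := ((normR x)^-1)%:C *: x.
have nx : normR (((normR x)^-1)%:C : R[i]^o) = (normR x)^-1.
  by rewrite normR_real ger0_norm// invr_ge0 ltW.
have y1 : normR y = 1 by rewrite normRZ nx mulVf// gt_eqF.
have ly : normR (l *: y - T y) <= d.
  have -> : l *: y - T y = ((normR x)^-1)%:C *: (l *: x - T x).
    by rewrite (linear_funZ lT) scalerBr !scalerA mulrC.
  by rewrite normRZ nx ler_pdivrMl// mulrC ltW.
have lK : normR (l : R[i]^o) <= K.
  have := le_normRB (l *: y) (T y); have := hM y; rewrite normRZ y1 /K; lra.
have [f [Ef f1 hf]] := hC y y1.
have [sE _ aE] := dE; have [lf _] := sE _ Ef.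
have Erf : E (r%:C *: f).
  by have := aE r%:C f 0 Ef; rewrite addr0; apply; case: dE.
have rr : normR (r%:C : R[i]^o) = r by rewrite normR_real gtr0_norm.
(* Scaling both [y] and [f] by [r] meets the size constraints and costs a factor [r * r]. *)
have [||k kn] := hr (r%:C *: y) (r%:C *: f) Erf _ _ n.
- by rewrite normRZ rr y1 mulr1.
- move=> z; rewrite -[(r%:C *: f) z]/(r%:C *: f z) normRZ rr.
  by rewrite ler_wpM2l// ltW.
have -> : weak_orbit T (r%:C *: y) (r%:C *: f) k = r%:C *: (r%:C *: f (iter k T y)).
  rewrite /weak_orbit (linear_funZ (linear_iter bT k)).
  by rewrite -[(r%:C *: f) _]/(r%:C *: f _) (linear_funZ lf).
rewrite !normRZ rr mulrA => hk.
have {hk} : C * normR (f (iter k T y)) < 1 / 8.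
  have : r * r * normR (f (iter k T y)) < 4 * (r * r / (32 * C)) by lra.
  have -> : 4 * (r * r / (32 * C)) = r * r * (1 / 8 / C) by field; lra.
  by rewrite ltr_pM2l ?mulr_gt0// ltr_pdivlMr// mulrC.
have K1 : 1 <= K by rewrite /K; lra.
have hMK z : normR (T z) <= K * normR z.
  by apply: le_trans (hM z) _; rewrite ler_wpM2r ?normR_ge0// /K; lra.
have hk := approx_eigenvector_iter bT y k K1 hMK lK.
have fk : normR (f (iter k T y)) >=
    normR (l : R[i]^o) ^+ k * normR (f y) - k%:R * K ^+ k * d.
  have := le_normRB (f (l ^+ k *: y)) (f (iter k T y)).
  rewrite normRBC -(linear_funB lf) (linear_funZ lf) normRZ.
  have := f1 (iter k T y - l ^+ k *: y).
  have -> : normR (l ^+ k : R[i]^o) = normR (l : R[i]^o) ^+ k.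
    elim: (k) => [|j IH]; first by rewrite !expr0 (normR_real (1 : R)) normr1.
    by rewrite !exprS (@normRM R l) IH.
  have : k%:R * K ^+ k * normR (l *: y - T y) <= k%:R * K ^+ k * d.
    by rewrite ler_wpM2l// mulr_ge0// exprn_ge0//; lra.
  lra.
have kN : k%:R <= N by rewrite ler_nat.
have kd : k%:R * d <= d * N by rewrite mulrC ler_wpM2l// ltW.
have lk : 1 / 2 <= normR (l : R[i]^o) ^+ k.
  have := @bernoulli_le R d k; rewrite ltW//= => /(_ _) hb.
  apply: (@le_trans _ _ ((1 - d) ^+ k)); first by apply: le_trans (hb _); lra.
  by rewrite lerXn2r// nnegrE ?normR_ge0//; lra.
(* Main term at least 1/4, error at most 1/8: this contradicts the strict bound 1/8. *)
have h1 : 1 / 2 * (1 / 2) <= normR (l : R[i]^o) ^+ k * (C * normR (f y)).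
  by rewrite ler_pM//; lra.
have h2 : C * (k%:R * K ^+ k * d) <= d * (C * N * K ^+ (4 * n)).
  rewrite [leRHS]mulrC -!mulrA ler_pM2l// !mulrA ler_wpM2r ?(ltW d0)//.
  rewrite ler_pM// ?exprn_ge0//; first by lra.
  by rewrite ler_weXn2l.
have h3 : C * (normR (l : R[i]^o) ^+ k * normR (f y) - k%:R * K ^+ k * d) <=
  C * normR (f (iter k T y)) by rewrite ler_pM2l.
move: h3; rewrite mulrBr (mulrCA C); lra.
Qed.

End BoundedBelow.

(** * From governing sets to countably many sparsity bounds *)

Section Governs.
Context {R : realType}.
Implicit Types (a : nat -> R[i]^o) (F : set (nat -> R[i]^o)).

Lemma c0P a : c0 a -> normR_cvg a 0.
Proof.
move=> ca e e0; have /cvgrPdist_lt/(_ e%:C) := ca; rewrite ltcR => /(_ e0)[N _ hN].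
exists N => n Nn; rewrite normRBC -ltcR -normRE; exact: hN.
Qed.

(** Some [s < t] belongs to the set under the infimum, and entries above [t] are also above [s]. *)
Lemma rearrangement_count a n (t : R) L : c0 a ->
  complex.Re (rearrangement (abs_seq a) n) < t ->
  (count (fun k => (t < normR (a k))%R) (iota 0 L) <= n)%N.
Proof.
move=> /c0P ca /= /inf_lt[|s [s0 sn] st].
  (* The infimum is over a non-empty set: entries from [N] on are below 1 and earlier ones are at
     most their sum. *)
  have [N hN] := ca 1 ltr01.
  have S0 : 0 <= \sum_(i < N) normR (a i) by apply: sumr_ge0 => i _; exact: normR_ge0.
  exists (1 + \sum_(i < N) normR (a i)) => /=; split; first by lra.
  rewrite (_ : [set k | _] = set0) ?card_ge0 //.
  apply/seteqP; split => // k /=; rewrite /abs_seq normRE ltcR => hk.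
  have [kN|/hN] := ltnP k N; last by rewrite subr0; lra.
  move: hk; rewrite (bigD1 (Ordinal kN)) //=.
  have : 0 <= \sum_(i < N | i != Ordinal kN) normR (a i).
    by apply: sumr_ge0 => i _; exact: normR_ge0.
  lra.
apply: leq_trans (geq_card_fset_set sn); rewrite -size_filter.
apply: uniq_leq_size; first by rewrite filter_uniq ?iota_uniq.
move=> k; rewrite mem_filter => /andP[tk _].
rewrite in_fset_set; last by apply/finite_set_leP; exists n.
by rewrite inE /= /abs_seq normRE ltcR; exact: lt_trans tk.
Qed.

(** [j] codes a pair (member of the family, multiplier). The summand [n.+1%:R^-1] keeps the bound
    strictly above multiples of [f] even where [f] vanishes, as [rearrangement_count] needs. *)
Definition bound_seq (f : nat -> nat -> R[i]^o) (j n : nat) : R :=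
  let p := odflt (0, 0)%N (unpickle j : option (nat * nat)) in
  p.2.+1%:R * (complex.Re (f p.1 n) + n.+1%:R^-1).

Lemma bound_seq_lt f j (e : R) : (forall i, c0_pos (f i)) -> 0 < e ->
  exists n, bound_seq f j n < e.
Proof.
move=> hf e0; rewrite /bound_seq; move: (odflt _ _) => [p m] /=.
have m0 : 0 < m.+1%:R :> R by [].
have e1 : 0 < e / m.+1%:R / 2 by rewrite !divr_gt0.
have [/c0P/(_ _ e1)[N hN] _] := hf p.
have [K _ hK] := near_infty_natSinv_lt (PosNum e1).
exists (maxn N K); rewrite mulrC -ltr_pdivlMr//.
have := hN _ (leq_maxl N K); have := hK _ (leq_maxr N K) => /=.
have := normR_Re (f p (maxn N K)); rewrite subr0.
have := ler_norm (complex.Re (f p (maxn N K))).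
by move: (e / _) (_^-1) => E w; lra.
Qed.

Lemma governs_sparse F f a : F `<=` c0_pos -> F `<=` range f -> governs F a ->
  exists j, sparse (bound_seq f j) a.
Proof.
move=> pF Ff [ca [g Fg [_ [c c0 hc]]]].
have [i _ fi] := Ff _ Fg; have [_ g0] := pF _ Fg.
exists (pickle (i, Num.bound c)) => n L; apply: rearrangement_count => //.
rewrite /bound_seq pickleK /= fi.
have := hc n; rewrite lecE => /andP[_] /=.
have /archi_boundP := c0; set m := Num.bound c => cm.
have gn : 0 <= complex.Re (g n) by have := g0 n; rewrite lecE => /andP[].
set t := inf _ => ht.
have tle : t <= c * complex.Re (g n).
  apply: le_trans (ler_norm t) _; rewrite -normR_real; apply: le_trans ht _.
  by case: (g n) => u v /=; rewrite mul0r subr0.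
apply: le_lt_trans tle _; rewrite mulrDr -[ltLHS]addr0 ler_ltD ?divr_gt0//.
by rewrite ler_wpM2r// -natr1; lra.
Qed.

End Governs.

Theorem corollary3p5 (R : realType) (X : completeNormedModType R[i])
    (E : set (X -> R[i]^o)) (T : X -> X) (F : set (nat -> R[i]^o)) :
  dual_subspace E -> dual_closed E -> almost_norming E ->
  bounded_linear T ->
  F `<=` c0_pos -> F !=set0 -> countable F ->
  (forall (x : X) (x' : X -> R[i]^o), E x' ->
     governs F (fun n => x' (iter n T x))) ->
  (spectral_radius T < 1)%E.
Proof.
move=> dE cE nE bT pF [f0 Ff0] cF hF.
have [f pf Ff] : exists2 f : nat -> nat -> R[i]^o, (forall i, c0_pos (f i)) & F `<=` range f.
  have /countable_injP[i hi] := cF.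
  (* The injection [i] is inverted on its image; [f0] fills the remaining indices. *)
  have /choice[f hf] n : exists g, F g /\ forall h, F h -> i h = n -> g = h.
    have [[g [Fg <-]]|ng] := pselect (exists g, F g /\ i g = n).
      by exists g; split => // h Fh ih; apply: hi; rewrite ?inE.
    by exists f0; split => // h Fh ih; case: ng; exists h.
  exists f => [n|g Fg]; first by apply: pF; case: (hf n).
  by exists (i g) => //; case: (hf (i g)) => _; exact.
have [||j [x0 [g0 [Eg0 [r r0 hr]]]]] := @baire_pair R X E dE cE
  (fun j => [set p | sparse (bound_seq f j) (weak_orbit T p.1 p.2)]).
- move=> j x g Eg /(not_sparse_open bT dE Eg)[r r0 hr].
  by exists r => // -[y h]; exact: hr.
- by move=> x g Eg; exact: governs_sparse pF Ff (hF x g Eg).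
have [d [d0 d1 hd]] := bounded_below_of_sparse bT dE nE r0
  (fun e => bound_seq_lt j pf)
  (sparse_polarization bT dE Eg0 (fun y g b => hr (y, g) b)).
by have [lT bTM] := bT; apply: (spectral_radius_lt1 lT bTM d0 d1).
Qed.
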